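(* Let $\ell,n,m\in\mathbb{N}^*=\{1,2,\dots\}$. The set $$S=\left\{(E,A,B)\in\Sigma_{\ell,n,m}\;\middle|\;\text{the system } \tfrac{\mathrm{d}}{\mathrm{d}t}(Ex)=Ax+Bu \text{ is impulse controllable}\right\}$$ is generic if, and only if, $\ell\leq n+m$.
   Context: $\Sigma_{\ell,n,m}:=\mathbb{R}^{\ell\times n}\times\mathbb{R}^{\ell\times n}\times\mathbb{R}^{\ell\times m}$, identified with $\mathbb{R}^{2\ell n+\ell m}$ by listing matrix entries. A set $\mathbb{V}\subseteq\mathbb{R}^N$ is an algebraic variety if it is the set of common zeros of finitely many polynomials in $\mathbb{R}[x_1,\dots,x_N]$; it is proper if $\mathbb{V}\neq\mathbb{R}^N$. A set $S\subseteq\mathbb{R}^N$ is generic if its complement is contained in some proper algebraic variety. A mapping $(x,u):\mathbb{R}\to\mathbb{R}^n\times\mathbb{R}^m$ is a solution of $\tfrac{\mathrm{d}}{\mathrm{d}t}(Ex)=Ax+Bu$ if $x\in\mathcal{L}^1_{\mathrm{loc}}(\mathbb{R},\mathbb{R}^n)$, $u\in\mathcal{L}^1_{\mathrm{loc}}(\mathbb{R},\mathbb{R}^m)$ (locally integrable functions), $Ex:\mathbb{R}\to\mathbb{R}^\ell$ is (locally) absolutely continuous, and $\tfrac{\mathrm{d}}{\mathrm{d}t}(Ex)(t)=Ax(t)+Bu(t)$ for all $t$ outside a Lebesgue nullset. The set of all solutions is denoted $\mathfrak{B}_{[E,A,B]}$. The system $(E,A,B)$ is impulse controllable if for every $x_0\in\mathbb{R}^n$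 there exists $(x,u)\in\mathfrak{B}_{[E,A,B]}$ with $Ex_0=Ex(0)$. *)

(* Defs.v *)
From mathcomp Require Import all_boot all_order all_algebra.
From mathcomp Require Import all_classical all_reals all_analysis.
(* The notations of mpoly clash with those of the analysis library. *)
From mathcomp Require mpoly.
Import -(notations) mpoly.

Set Implicit Arguments.
Unset Strict Implicit.
Unset Printing Implicit Defensive.

Import Order.TTheory GRing.Theory Num.Theory.
Import numFieldNormedType.Exports.

Local Open Scope classical_set_scope.
Local Open Scope ring_scope.

Definition algebraic_variety (R : realType) (N : nat) (V : set 'rV[R]_N) :=
  exists ps : seq (mpoly N R),
    V = [set v | forall p, p \in ps -> meval (fun i => v 0 i) p = 0].

Definition generic (R : realType) (N : nat) (S : set 'rV[R]_N) :=
  exists V : set 'rV[R]_N,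
    [/\ algebraic_variety V, V <> setT & ~` S `<=` V].

Definition system (R : realType) (l n m : nat) : Type :=
  'M[R]_(l, n) * 'M[R]_(l, n) * 'M[R]_(l, m).

Definition system_vec (R : realType) (l n m : nat) (s : system R l n m) :
    'rV[R]_(l * n + l * n + l * m) :=
  let: (E, A, B) := s in row_mx (row_mx (mxvec E) (mxvec A)) (mxvec B).

(* Measurability is with respect to the Lebesgue sigma-algebra, hence the
   completed measure: the domain of lebesgue_measure is the Borel one. *)
Definition loc_integrable (R : realType) (k : nat) (f : R -> 'cV[R]_k) :=
  forall (i : 'I_k) (K : set R), compact K ->
    (@completed_lebesgue_measure R).-integrable K (fun t => (f t i 0)%:E).

Definition abs_continuous_on (R : realType) (V : normedModType R)
    (a b : R) (f : R -> V) :=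
  forall e : R, 0 < e -> exists2 d : R, 0 < d &
    forall (k : nat) (p q : 'I_k -> R),
      (forall i, [/\ a <= p i, p i <= q i & q i <= b]) ->
      trivIset setT (fun i => `]p i, q i[%classic) ->
      \sum_(i < k) (q i - p i) < d ->
      \sum_(i < k) `|f (q i) - f (p i)| < e.

Definition loc_abs_continuous (R : realType) (V : normedModType R)
    (f : R -> V) :=
  forall a b : R, abs_continuous_on a b f.

Definition solution (R : realType) (l n m : nat) (s : system R l n m)
    (x : R -> 'cV[R]_n) (u : R -> 'cV[R]_m) : Prop :=
  let: (E, A, B) := s in
  [/\ loc_integrable x,
      loc_integrable u,
      loc_abs_continuous (fun t => E *m x t) &
      {ae (@lebesgue_measure R), forall t,
        is_derive (t : R) (1 : R) (fun r : R => E *m x r) (A *m x t + B *m u t)}].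

Definition behavior (R : realType) (l n m : nat) (s : system R l n m) :
    set ((R -> 'cV[R]_n) * (R -> 'cV[R]_m)) :=
  [set xu | solution s xu.1 xu.2].

Definition impulse_controllable (R : realType) (l n m : nat)
    (s : system R l n m) : Prop :=
  let: (E, _, _) := s in
  forall x0 : 'cV[R]_n, exists x u, behavior s (x, u) /\ E *m x0 = E *m x 0.

(* Main.v *)
(** If [[E, B]] has a right inverse, [E X + B Y = 1], then for every [x0] the
    solution of the linear ODE [x' = X A x], [x(0) = x0], together with
    [u = - Y A x], is a solution of the system; when [l <= n + m] this happens
    off the zero set of an [l]-minor of [[E, B]].

    If [l > n + m], then off the zero set of an [(n + m + 1)]-minor of
    [[E, B, A e]] the matrix [E] has a left inverse and some row [w] satisfies
    [w E = 0], [w B = 0] and [w A e = 1].  Along a solution, [w (E x)' = w A x]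
    vanishes almost everywhere; since [x] is recovered from the continuous
    function [E x], it vanishes at [0] too, so no solution starts at [e].  A
    line joining a point where this minor is nonzero to a point outside a given
    proper variety contains a point with both properties, so impulse
    controllability is not generic. *)

Require Import Defs.
From mathcomp Require Import all_boot all_order all_algebra.
From mathcomp Require Import all_classical all_reals all_analysis.
From mathcomp Require Import measurable_realfun.
From mathcomp Require mpoly.
Import -(notations) mpoly.

Set Implicit Arguments.
Unset Strict Implicit.

Import Order.TTheory GRing.Theory Num.Theory.
Import numFieldNormedType.Exports.

Local Open Scope classical_set_scope.
Local Open Scope ring_scope.

(** * Restriction of polynomials to lines, and determinantal varieties *)

Section PolynomialFunctions.
Context {R : realType}.

Lemma meval_line (N : nat) (p : mpoly N R) (v w : 'I_N -> R) :
  exists P : {poly R}, forall t,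
    P.[t] = meval (fun i => v i + t * (w i - v i)) p.
Proof.
exists (mmap polyC (fun i => (v i)%:P + 'X * (w i - v i)%:P) p) => t.
rewrite mevalE /mmap horner_sum; apply: eq_bigr => m _.
rewrite /mmap1 hornerM hornerC horner_prod; congr (_ * _).
by apply: eq_bigr => i _; rewrite !hornerE.
Qed.

(** The numbers 0, 1, 2, ... below [size P] are distinct in characteristic zero and outnumber the
    degree, so they cannot all be roots. *)
Lemma poly_nonroot (P : {poly R}) : P != 0 -> exists t, ~~ root P t.
Proof.
move=> P0; apply: contrapT => noroot.
have Pall t : root P t by apply: contrapT => Pt; apply: noroot; exists t; apply/negP.
have := @max_poly_roots _ P [seq k%:R | k <- iota 0 (size P)] P0.
rewrite size_map size_iota ltnn => F; suff : false by []; apply: F.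
  by apply/allP => t _; exact: Pall.
by rewrite map_inj_uniq ?iota_uniq// => i j /eqP; rewrite eqr_nat => /eqP.
Qed.

(** On the line from [v] to [w] both polynomials restrict to nonzero univariate ones, as parameter 0
    shows for [p] and parameter 1 for [q]. Their product then has a non-root. *)
Lemma meval_common_nonzero (N : nat) (p q : mpoly N R) (v w : 'I_N -> R) :
  meval v p != 0 -> meval w q != 0 ->
  exists z : 'I_N -> R, meval z p != 0 /\ meval z q != 0.
Proof.
have [P EP] := meval_line p v w; have [Q EQ] := meval_line q v w.
move=> pv qw.
have P0 : P != 0.
  apply: contra_neq pv => P0; have := EP 0; rewrite P0 horner0 => ->.
  by apply: meval_eq => i; rewrite mul0r addr0.
have Q0 : Q != 0.
  apply: contra_neq qw => Q0; have := EQ 1; rewrite Q0 horner0 => ->.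
  by apply: meval_eq => i; rewrite mul1r addrC subrK.
have [t] := poly_nonroot (mulf_neq0 P0 Q0).
rewrite rootM negb_or => /andP[Pt Qt].
by exists (fun i => v i + t * (w i - v i)); rewrite -EP -EQ.
Qed.

Lemma algebraic_variety_det (N k : nat) (F : 'M[mpoly N R]_k) :
  algebraic_variety
    [set v : 'rV[R]_N | \det (map_mx (meval (fun i => v 0 i)) F) = 0].
Proof.
exists [:: \det F]; apply/seteqP; split => v /=.
  by rewrite det_map_mx => Fv p /[!inE] /eqP ->.
by rewrite det_map_mx; apply; rewrite inE.
Qed.

End PolynomialFunctions.

(** * Block coordinates on the space of systems *)

Section SystemBlocks.
Context {T : Type} {l n m : nat}.
Implicit Types v : 'rV[T]_(l * n + l * n + l * m).

(** The entry type is arbitrary so that the blocks can be taken of a real vector as well as of a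
    vector of indeterminates. *)
Definition vecE v : 'M[T]_(l, n) := vec_mx (lsubmx (lsubmx v)).
Definition vecA v : 'M[T]_(l, n) := vec_mx (rsubmx (lsubmx v)).
Definition vecB v : 'M[T]_(l, m) := vec_mx (rsubmx v).

End SystemBlocks.

Section GenericSystem.
Context {R : realType} {l n m : nat}.
Local Notation N := (l * n + l * n + l * m)%N.

Lemma system_vec_parts (v : 'rV[R]_N) :
  system_vec (vecE v, vecA v, vecB v) = v.
Proof. by rewrite /system_vec !vec_mxK !hsubmxK. Qed.

Lemma parts_system_vec E A (B : 'M[R]_(l, m)) :
  let v := system_vec (E : 'M[R]_(l, n), A, B) in
  [/\ vecE v = E, vecA v = A & vecB v = B].
Proof.
by rewrite /vecE /vecA /vecB /system_vec !(row_mxKl, row_mxKr) !mxvecK.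
Qed.

(** The generic point: minors built from its blocks are polynomials, and evaluating them at [v]
    gives the minors of the system coded by [v]. *)
Definition varX : 'rV[mpoly N R]_N := \row_i mpolyX _ (mnm1 i).

Lemma map_varX (v : 'rV[R]_N) : map_mx (meval (fun i => v 0 i)) varX = v.
Proof. by apply/rowP => i; rewrite !mxE mevalXU. Qed.

Lemma map_parts_varX (v : 'rV[R]_N) :
  let ev := meval (fun i => v 0 i) in
  [/\ map_mx ev (vecE varX) = vecE v, map_mx ev (vecA varX) = vecA v
    & map_mx ev (vecB varX) = vecB v].
Proof.
by rewrite /vecE /vecA /vecB !map_vec_mx !(map_lsubmx, map_rsubmx) map_varX.
Qed.

Lemma map_meval_mpolyC (v : 'rV[R]_N) a b (J : 'M[R]_(a, b)) :
  map_mx (meval (fun i => v 0 i)) (map_mx (@mpolyC N R) J) = J.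
Proof. by apply/matrixP => i j; rewrite !mxE mevalC. Qed.

End GenericSystem.

(** * Regularity of vector functions and linear differential equations *)

Section VectorFunctions.
Context {R : realType}.

Lemma is_derive_mxP (p q : nat) (f : R -> 'M[R]_(p, q)) (t : R) D :
  is_derive t 1 f D <-> forall i j, is_derive t 1 (fun r => f r i j) (D i j).
Proof.
split=> [fD i j|fD].
  have df : derivable f t 1 by exact: ex_derive.
  have := derive_mx df; rewrite derive_val => ->; rewrite mxE.
  by apply: derivableP; move/derivable_mxP : df; apply.
have df : derivable f t 1.
  by apply/derivable_mxP => i j; apply: ex_derive.
apply: (is_derive_eq (derivableP df)).
by rewrite derive_mx//; apply/matrixP => i j; rewrite mxE derive_val.
Qed.

Lemma is_derive_mulmx (p q r : nat) (E : 'M[R]_(p, q)) (f : R -> 'M[R]_(q, r))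
    (t : R) D :
  is_derive t 1 f D -> is_derive t 1 (fun s => E *m f s) (E *m D).
Proof.
move=> /is_derive_mxP fD; apply/is_derive_mxP => i j.
have -> : (fun s => (E *m f s) i j) = \sum_(k < q) (E i k \*: (fun s => f s k j)).
  by apply/funext => s; rewrite mxE fct_sumE.
rewrite mxE; exact: is_derive_sum.
Qed.

Lemma is_derive_continuous (V : normedModType R) (f : R -> V) (t : R) D :
  is_derive t 1 f D -> {for t, continuous f}.
Proof.
move=> fD; apply: differentiable_continuous; apply/derivable1_diffP.
exact: ex_derive.
Qed.

Lemma loc_abs_continuous_continuous (V : normedModType R) (f : R -> V) :
  loc_abs_continuous f -> continuous f.
Proof.
move=> fac t; apply/cvgrPdist_lt => e e0.
have [d d0 fd] := fac (t - 1) (t + 1) e e0.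
near=> s.
have st : `|t - s| < d by near: s; apply: cvgr_dist_lt.
have st1 : `|t - s| < 1 by near: s; apply: cvgr_dist_lt.
have {}fd (p q : R) : t - 1 <= p -> p <= q -> q <= t + 1 -> q - p < d ->
    `|f q - f p| < e.
  move=> tp pq qt pqd.
  (* Absolute continuity is used for a single interval. *)
  have := fd 1 (fun=> p) (fun=> q); rewrite !big_ord1; apply => //.
  by move=> i j _ _ _; rewrite !ord1.
have [ts|ts] := leP t s.
  rewrite distrC; apply: fd => //.
  - by rewrite gerBl.
  - by move: st1; rewrite distrC ltr_norml => /andP[_ /ltW]; rewrite lerBlDl.
  - by rewrite distrC in st; apply: le_lt_trans st; exact: ler_norm.
apply: fd.
- by move: st1; rewrite ltr_norml => /andP[_ /ltW]; rewrite lerBlDr lerBlDl addrC.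
- exact: ltW.
- by rewrite lerDl.
- by apply: le_lt_trans st; exact: ler_norm.
Unshelve. all: by end_near. Qed.

Lemma lipschitz_abs_continuous (V : normedModType R) (f : R -> V) (a b K : R) :
  (forall p q, a <= p -> p <= q -> q <= b -> `|f q - f p| <= K * (q - p)) ->
  abs_continuous_on a b f.
Proof.
move=> fK e e0.
have K0 : 0 < `|K| + 1 by rewrite ltr_wpDl.
exists (e / (`|K| + 1)); first exact: divr_gt0.
move=> k p q pq _; rewrite ltr_pdivlMr// mulrC.
apply: le_lt_trans; rewrite mulr_sumr; apply: ler_sum => i _.
have [ap piq qb] := pq i.
apply: le_trans (fK _ _ ap piq qb) _; apply: ler_wpM2r; first by rewrite subr_ge0.
by rewrite (le_trans (ler_norm _))// lerDl.
Qed.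

(** [D] is bounded on the compact interval, so the mean value theorem, applied to each entry, gives
    a Lipschitz bound in the max norm. *)
Lemma C1_abs_continuous (n : nat) (f D : R -> 'cV[R]_n) :
  (forall t : R, is_derive t (1 : R) f (D t)) -> continuous D ->
  loc_abs_continuous f.
Proof.
move=> fD Dc a b.
have Db : exists K, 0 <= K /\ forall t, a <= t <= b -> `|D t| <= K.
  have := @compact_bounded R 'cV[R]_n (D @` `[a, b]).
  have cD : compact (D @` `[a, b]).
    apply: continuous_compact; last exact: segment_compact.
    by apply: continuous_subspaceT.
  move=> /(_ cD)[M [_ M1]]; exists (`|M| + 1); split; first by rewrite addr_ge0.
  move=> t tab; apply: M1 => /=; last by exists t; rewrite //= in_itv.
  by rewrite (le_lt_trans (ler_norm _))// ltrDl.
case: Db => K [K0 DK].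
apply: (@lipschitz_abs_continuous _ _ _ _ K) => p q ap pq qb.
rewrite [leLHS]/Num.Def.normr/= mx_normrE (bigmax_le _ _)//=.
  by rewrite mulr_ge0// subr_ge0.
move=> [i j] _ /=.
have fij (t : R) : is_derive t (1 : R) (fun r => f r i j) (D t i j).
  by have /is_derive_mxP := fD t; apply.
have [c cpq] := @MVT_segment R (fun r => f r i j) (fun r => D r i j) p q pq
  (fun x _ => fij x) (continuous_subspaceT (fun x => is_derive_continuous (fij x))).
rewrite !mxE => ->; rewrite normrM [`|q - p|]ger0_norm ?subr_ge0//.
apply: ler_wpM2r; first by rewrite subr_ge0.
apply: le_trans (DK c _); last first.
  move: cpq; rewrite !in_itv/= => /andP[pc cq].
  by rewrite (le_trans ap pc) (le_trans cq qb).
rewrite [leRHS]/Num.Def.normr/= mx_normrE.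
exact: (le_bigmax _ (fun ij => `|D c ij.1 ij.2|) (i, j)).
Qed.

(** A continuous function is Borel, hence Lebesgue, measurable, and it is bounded on [K], which has
    finite measure. *)
Lemma continuous_loc_integrable (n : nat) (f : R -> 'cV[R]_n) :
  continuous f -> loc_integrable f.
Proof.
move=> fc i K cK.
have fic : continuous (fun t => f t i 0).
  move=> t; apply: (@continuous_comp _ _ _ f (fun M : 'cV[R]_n => M i 0)).
    exact: fc.
  exact: coord_continuous.
have borel (A : set R) : measurable (A : set (measurableTypeR R)) ->
    measurable (A : set (caratheodory_type (@wlength R idfun)^*%mu)).
  exact: sub_caratheodory.
have mK : measurable (K : set (measurableTypeR R)) by exact: compact_measurable.
pose CT := caratheodory_type (@wlength R idfun)^*%mu.
apply: (@measurable_bounded_integrable _ CT R completed_lebesgue_measure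
  (fun t : R => f t i 0) K).
- exact: borel.
- exact: (@compact_finite_measure R K).
- move=> _ Y mY; apply: borel.
  have /(_ mK Y mY) := @measurable_funTS _ _ _ _ K _ (continuous_measurable_fun fic).
  exact.
- have /compact_bounded[M [_ mrt]] : compact ((fun t => f t i 0) @` K).
    by apply: continuous_compact => //; exact: continuous_subspaceT.
  by exists M; split; rewrite ?num_real// => r Mr t Kt; apply: mrt => //=; exists t.
Qed.

(** Comparison with [C] times the exponential series at [|r * x|]. *)
Lemma is_cvg_pseries_fact_geometric (c : R^nat) (C r x : R) :
  (forall k, `|c k| <= C * (r ^+ k / k`!%:R)) -> cvgn (pseries c x).
Proof.
move=> cle; apply: normed_cvg.
have C0 : 0 <= C by have := cle 0; rewrite expr0 fact0 divr1 mulr1; exact: le_trans.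
apply: (@series_le_cvg _ _ (C *: exp_coeff (`|r * x|))).
- by move=> k; exact: normr_ge0.
- by move=> k; apply: mulr_ge0 => //; exact: exp_coeff_ge0.
- move=> k /=; rewrite normrM normrX /exp_coeff /=.
  have := cle k => /(ler_wpM2r (exprn_ge0 k (normr_ge0 x))) /le_trans; apply.
  rewrite -mulrA; apply: ler_wpM2l => //.
  rewrite mulrAC -exprMn; apply: ler_wpM2r; first by rewrite invr_ge0.
  rewrite normrM exprMn exprMn; apply: ler_wpM2r; first exact: exprn_ge0.
  by rewrite -normrX ler_norm.
- by apply: is_cvg_seriesZ; exact: is_cvg_series_exp_coeff.
Qed.

(** The solution is the matrix exponential of [t M] applied to [x0], built coordinatewise as the
    power series with coefficients [c i k], the entries of [M ^ k x0] over [k!], and differentiated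
    term by term. *)
Lemma linear_ode (n : nat) (M : 'M[R]_n) (x0 : 'cV[R]_n) :
  exists x : R -> 'cV[R]_n,
    x 0 = x0 /\ forall t : R, is_derive t (1 : R) x (M *m x t).
Proof.
pose v k : 'cV[R]_n := iter k (mulmx M) x0.
pose c i k : R := v k i 0 / k`!%:R.
pose r : R := \sum_i \sum_j `|M i j|.
pose C : R := \sum_i `|x0 i 0|.
(* [r] dominates the absolute sum of each row of [M], so each application of [M] costs at most a
   factor [r]. *)
have vle k i : `|v k i 0| <= C * r ^+ k.
  elim: k i => [|k IH] i.
    by rewrite expr0 mulr1 /C (bigD1 i)//= lerDl sumr_ge0.
  rewrite mxE; apply: le_trans (ler_norm_sum _ _ _) _.
  apply: (@le_trans _ _ (\sum_j `|M i j| * (C * r ^+ k))).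
    by apply: ler_sum => j _; rewrite normrM; apply: ler_wpM2l => //; exact: IH.
  rewrite -mulr_suml exprS [leRHS]mulrCA; apply: ler_wpM2r.
    exact: le_trans (normr_ge0 _) (IH i).
  rewrite /r [leRHS](bigD1 i)//= lerDl; apply: sumr_ge0 => *; exact: sumr_ge0.
have diffs_c i k : pseries_diffs (c i) k = \sum_j M i j * c j k.
  rewrite /pseries_diffs /c factS natrM invfM mulrCA mulVKf//.
  by rewrite mxE mulr_suml; apply: eq_bigr => j _; rewrite mulrA.
have diffs_cE i k : pseries_diffs (c i) k = v k.+1 i 0 / k`!%:R.
  by rewrite /pseries_diffs /c factS natrM invfM mulrCA mulVKf.
have diffs_diffs_cE i k :
    pseries_diffs (pseries_diffs (c i)) k = v k.+2 i 0 / k`!%:R.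
  by rewrite {1}/pseries_diffs diffs_cE factS natrM invfM mulrCA mulVKf.
(* The shift [d] treats the series and its first two formal derivatives at once, with [d] equal to
   0, 1 and 2. *)
have cv d y (i : 'I_n) : cvgn (pseries (fun k => v (k + d)%N i 0 / k`!%:R) y).
  apply: (@is_cvg_pseries_fact_geometric _ (C * r ^+ d) r) => k.
  rewrite normrM mulrA [X in _ * X]ger0_norm ?invr_ge0//.
  apply: ler_wpM2r; first by rewrite invr_ge0.
  by rewrite -mulrA -exprD addnC.
have cv0 y i : cvgn (pseries (c i) y).
  rewrite (_ : c i = fun k => v (k + 0)%N i 0 / k`!%:R)//.
  by apply/funext => k; rewrite addn0.
have cv1 y i : cvgn (pseries (pseries_diffs (c i)) y).
  rewrite (_ : pseries_diffs _ = fun k => v (k + 1)%N i 0 / k`!%:R)//.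
  by apply/funext => k; rewrite addn1 diffs_cE.
have cv2 y i : cvgn (pseries (pseries_diffs (pseries_diffs (c i))) y).
  rewrite (_ : pseries_diffs _ = fun k => v (k + 2)%N i 0 / k`!%:R)//.
  by apply/funext => k; rewrite addn2 diffs_diffs_cE.
exists (fun t => \col_i limn (pseries (c i) t)); split.
  apply/colP => i; rewrite mxE; apply/cvg_lim => //.
  (* At 0 every partial sum with at least one term equals the constant coefficient; the empty sum
     must be excluded. *)
  apply: cvg_near_cst; near=> k.
  have k0 : (0 < k)%N by near: k; exists 1%N.
  rewrite /pseries /series /= -(prednK k0) big_nat_recl//= expr0 mulr1.
  rewrite big1 => [|j _].
    by rewrite addr0 /c fact0 divr1.
  by rewrite exprS mul0r mulr0.
move=> t; apply/is_derive_mxP => i j; rewrite ord1.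
have -> : (fun s : R => (\col_i limn (pseries (c i) s)) i 0) =
    (fun s : R => limn (pseries (c i) s)).
  by apply/funext => s; rewrite mxE.
(* Convergence at [|t| + 1], a point of larger modulus than [t], justifies termwise differentiation
   at [t]. *)
have := @pseries_snd_diffs _ (c i) (`|t| + 1) t (cv0 _ _) (cv1 _ _) (cv2 _ _).
have -> : `|t| < `|(`|t| + 1)| by rewrite [ltRHS]ger0_norm ?ltrDl// addr_ge0.
move=> /(_ isT) /is_derive_eq; apply.
apply/cvg_lim => //.
have -> : pseries (pseries_diffs (c i)) t =
    fun N => \sum_k M i k * pseries (c k) t N.
  apply/funext => N; rewrite /pseries /series /=.
  under eq_bigr do rewrite diffs_c mulr_suml.
  rewrite exchange_big/=; apply: eq_bigr => k _.
  by rewrite mulr_sumr; apply: eq_bigr => q _; rewrite mulrA.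
rewrite mxE; apply: cvg_big => [|k _]; first exact: add_continuous.
rewrite mxE.
by apply: cvgMr; exact: cv0.
Unshelve. all: by end_near. Qed.

End VectorFunctions.

(** * Impulse controllability of a fixed system *)

Section ImpulseControllability.
Context {R : realType} {l n m : nat}.
Implicit Types (E A : 'M[R]_(l, n)) (B : 'M[R]_(l, m)).

Lemma right_inverse_impulse_controllable E A B
    (X : 'M[R]_(n, l)) (Y : 'M[R]_(m, l)) :
  E *m X + B *m Y = 1%:M -> impulse_controllable (E, A, B).
Proof.
move=> EXBY x0; have [x [x_0 dx]] := linear_ode (X *m A) x0.
have cx : continuous x by move=> t; apply: is_derive_continuous (dx t).
have dmul p (F : 'M[R]_(p, n)) t := is_derive_mulmx F (dx t).
have cmul p (F : 'M[R]_(p, n)) : continuous (fun t => F *m x t).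
  by move=> t; apply: is_derive_continuous (dmul _ F t).
exists x, (fun t => - (Y *m A) *m x t); split; last by rewrite x_0.
split => /=.
- exact: continuous_loc_integrable.
- exact: continuous_loc_integrable.
- apply: C1_abs_continuous (dmul _ E) _.
  rewrite (_ : (fun t => _) = fun t => E *m (X *m A) *m x t)//.
  by apply/funext => t; rewrite mulmxA.
- apply: aeW => t; apply: is_derive_eq (dmul _ E t) _.
  (* Splitting [A x] by the right inverse gives [E X A x], the derivative of [E x], plus [B Y A x],
     which the input cancels. *)
  have -> : A *m x t = (E *m X + B *m Y) *m (A *m x t) by rewrite EXBY mul1mx.
  by rewrite mulmxDl mulNmx mulmxN !mulmxA addrK.
Qed.

(** The ball has measure [2 e > 0], so it cannot lie in a null set. *)
Lemma ae_exists_ball (P : R -> Prop) (c e : R) : 0 < e ->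
  {ae (@lebesgue_measure R), forall t, P t} -> exists2 t, ball c e t & P t.
Proof.
move=> e0 [N [mN N0 PN]]; apply: contrapT => noP.
have cN : ball c e `<=` N.
  by move=> t ct; apply: PN => Pt; apply: noP; exists t.
have : ((e *+ 2)%:E <= 0 :> \bar R)%E.
  rewrite -N0 -(lebesgue_measure_ball c (ltW e0)).
  by apply: le_measure; rewrite ?inE//; exact: measurable_ball.
by rewrite lee_fin pmulrn_lle0// leNgt e0.
Qed.

Lemma impulse_controllable_annihilator E A B (L : 'M[R]_(n, l)) (w : 'rV[R]_l) :
  L *m E = 1%:M -> w *m E = 0 -> w *m B = 0 ->
  impulse_controllable (E, A, B) -> w *m A = 0.
Proof.
move=> LE wE wB ctrl; apply/rowP => j; rewrite [RHS]mxE; apply/eqP.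
have [x [u [[_ _ acEx solEx] Ex0]]] := ctrl (delta_mx j 0).
have cEx := loc_abs_continuous_continuous acEx.
have x_0 : x 0 = delta_mx j 0.
  by rewrite -[LHS]mul1mx -LE -mulmxA -Ex0 mulmxA LE mul1mx.
(* [g] is [w A x] rewritten through [E x], the function whose continuity the notion of solution
   provides. *)
pose g t := \sum_k (w *m A *m L) 0 k * (E *m x t) k 0.
have gE t : g t = (w *m A *m x t) 0 0.
  by rewrite -[x t]mul1mx -LE -(mulmxA L) mulmxA [RHS]mxE.
have cg : continuous g.
  move=> t; apply: cvg_big => [|k _]; first exact: add_continuous.
  apply: cvgMr.
  apply: (@continuous_comp _ _ _ (fun s => E *m x s)
    (fun M : 'cV[R]_l => M k 0)).
    exact: cEx.
  exact: coord_continuous.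
have g_sol t : is_derive t (1 : R) (fun r => E *m x r) (A *m x t + B *m u t) ->
    g t = 0.
  move=> /(is_derive_mulmx w).
  have -> : (fun s => w *m (E *m x s)) = fun=> 0.
    by apply/funext => s; rewrite mulmxA wE mul0mx.
  move=> dE; rewrite gE; have := @derive_val _ _ _ _ _ _ _ dE.
  by rewrite derive_cst mulmxDr !mulmxA wB mul0mx addr0 => <-; rewrite mxE.
suff : g 0 = 0 by rewrite gE x_0 -colE mxE => ->.
apply: contrapT => /eqP g0.
(* Near 0, [g] stays within [|g 0|] of [g 0] and so cannot vanish, yet it vanishes almost
   everywhere. *)
have := cg 0 => /cvgrPdist_lt /(_ `|g 0|); rewrite normr_gt0 g0 => /(_ isT).
move=> /nbhs_ballP[e /= e0 ge].
have [t te /g_sol gt] := ae_exists_ball 0 e0 solEx.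
by have := ge t te; rewrite /= gt subr0 ltxx.
Qed.

End ImpulseControllability.

(** * The two directions of the genericity criterion *)

Section Genericity.
Context {R : realType} {l n m : nat}.
Local Notation N := (l * n + l * n + l * m)%N.

Lemma generic_impulse_controllable : (l <= n + m)%N ->
  generic (@system_vec R l n m @` [set s | impulse_controllable s]).
Proof.
(* Multiplying by [J] on the right keeps the first [l] columns, so [\det F] is the leading [l]-minor
   of [[E, B]]. *)
move=> lnm; pose J : 'M[R]_(n + m, l) := pid_mx l.
pose F := row_mx (vecE varX) (vecB varX) *m map_mx (@mpolyC N R) J.
have evF (v : 'rV[R]_N) :
    map_mx (meval (fun i => v 0 i)) F = row_mx (vecE v) (vecB v) *m J.
  have [mE _ mB] := map_parts_varX v.
  by rewrite map_mxM map_row_mx mE mB map_meval_mpolyC.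
exists [set v | \det (map_mx (meval (fun i => v 0 i)) F) = 0]; split.
- exact: algebraic_variety_det.
(* Properness: at the system with [[E, B] = [I, 0]] the minor is 1. *)
- pose W : 'M[R]_(l, n + m) := pid_mx l.
  pose v := system_vec (lsubmx W, 0, rsubmx W).
  move=> /seteqP[_ /(_ v Logic.I)] /=; rewrite evF.
  have [-> _ ->] := parts_system_vec (lsubmx W) 0 (rsubmx W).
  rewrite hsubmxK /W /J mul_pid_mx minnn (minn_idPr lnm) pid_mx_1 det1.
  by move/eqP; rewrite oner_eq0.
- move=> v nSv /=; apply: contrapT => /eqP; rewrite evF => det0; apply: nSv.
  exists (vecE v, vecA v, vecB v); last exact: system_vec_parts.
  set C := _ *m J in det0; pose K := J *m invmx C.
  apply: (right_inverse_impulse_controllable _ (X := usubmx K) (Y := dsubmx K)).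
  rewrite -mul_row_col vsubmxK /K mulmxA mulmxV//.
  by rewrite unitmxE unitfE.
Qed.

Lemma generic_impulse_controllable_leq : (0 < n)%N ->
  generic (@system_vec R l n m @` [set s | impulse_controllable s]) ->
  (l <= n + m)%N.
Proof.
move=> n0 [V [[ps ->] VT SV]]; rewrite leqNgt; apply/negP => nml.
have {VT} [v [p pps pv]] : exists v : 'rV[R]_N,
    exists2 p, p \in ps & meval (fun i => v 0 i) p != 0.
  apply: contrapT => no; apply: VT; apply/seteqP; split => // v _ p pps.
  by apply: contrapT => /eqP pv; apply: no; exists v, p.
pose j0 := Ordinal n0.
pose d : 'cV[R]_n := delta_mx j0 0.
(* Multiplying by [J] on the left keeps the first [n + m + 1] rows, so [\det F] is the leading minor
   of [[E, B, A d]]. *)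
pose J : 'M[R]_(n + m + 1, l) := pid_mx (n + m + 1).
pose block (b : 'rV[R]_N) := row_mx (row_mx (vecE b) (vecB b)) (vecA b *m d).
pose F := map_mx (@mpolyC N R) J *m
  row_mx (row_mx (vecE varX) (vecB varX)) (vecA varX *m map_mx (@mpolyC N R) d).
have evF (b : 'rV[R]_N) : map_mx (meval (fun i => b 0 i)) F = J *m block b.
  have [mE mA mB] := map_parts_varX b.
  by rewrite map_mxM !map_row_mx map_mxM mE mA mB !map_meval_mpolyC.
pose W : 'M[R]_(l, n + m + 1) := pid_mx (n + m + 1).
pose E0 := lsubmx (lsubmx W); pose B0 := rsubmx (lsubmx W).
(* Since [d^T d = 1], this choice makes [A0 d] the last column of [W], so [block v0] is [W] and its
   minor is 1. *)
pose A0 := rsubmx W *m d^T.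
pose v0 := system_vec (E0, A0, B0).
have Fv0 : meval (fun i => v0 0 i) (\det F) != 0.
  rewrite -det_map_mx evF /block.
  have [-> -> ->] := parts_system_vec E0 A0 B0.
  rewrite /A0 -mulmxA trmx_delta mul_delta_mx.
  have -> : delta_mx 0 0 = 1%:M :> 'M[R]_1.
    by apply/matrixP => i j; rewrite !ord1 !mxE.
  have nml1 : (n + m + 1 <= l)%N by rewrite addn1.
  rewrite mulmx1 !hsubmxK /W /J mul_pid_mx minnn (minn_idPr nml1) pid_mx_1 det1.
  exact: oner_neq0.
have [z [pz Fz]] := meval_common_nonzero pv Fv0.
pose y : 'rV[R]_N := \row_i z i.
have mevy q : meval (fun i => y 0 i) q = meval z q.
  by apply: meval_eq => i; rewrite mxE.
have [[[E A] B] ctrl yE] :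
    (@system_vec R l n m @` [set s | impulse_controllable s]) y.
  apply: contrapT => /SV /(_ p pps) /eqP; apply/negP.
  by rewrite mevy.
move: Fz; rewrite -mevy -det_map_mx evF.
have [EE AE BE] := parts_system_vec E A B.
rewrite /block -yE EE AE BE; set G := row_mx _ _; set C := J *m G => detC.
(* [K] is a left inverse of [G = [E, B, A d]]: its first [n] rows form the left inverse [L] of [E],
   and its last row is the annihilator [w] with [w A d = 1]. *)
pose K := invmx C *m J.
have KG : K *m G = 1%:M by rewrite -mulmxA mulVmx// unitmxE unitfE.
have : dsubmx K *m G = row_mx (row_mx 0 0) 1%:M.
  by rewrite mul_dsub_mx KG scalar_mx_block /block_mx col_mxKd row_mx0.
rewrite !mul_mx_row => /eq_row_mx[/eq_row_mx[wE wB] wAd].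
have : usubmx (usubmx K) *m G = row_mx (row_mx 1%:M 0) 0.
  rewrite !mul_usub_mx KG scalar_mx_block /block_mx col_mxKu.
  by rewrite scalar_mx_block -(@col_mx0 R n m 1) -block_mxEh /block_mx col_mxKu.
rewrite !mul_mx_row => /eq_row_mx[/eq_row_mx[LE _] _].
have wA := impulse_controllable_annihilator LE wE wB ctrl.
move: wAd; rewrite mulmxA wA mul0mx => /matrixP /(_ 0 0).
by rewrite !mxE eqxx => /esym /eqP; rewrite oner_eq0.
Qed.
End Genericity.

Theorem proposition5p8 (R : realType) (l n m : nat)
    (hl : (0 < l)%N) (hn : (0 < n)%N) (hm : (0 < m)%N) :
  generic (@system_vec R l n m @` [set s | impulse_controllable s])
  <-> (l <= n + m)%N.
Proof.
split; first exact: generic_impulse_controllable_leq.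
exact: generic_impulse_controllable.
Qed.
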